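(* Let $\mathcal{A}$ be a finite alphabet, let $\Omega\subseteq\mathcal{A}^{\mathbb{N}}$ be a shift space, let $l\ge 2$ be an integer, and let $\mathsf{X}_\Omega^{(l)}$ be the associated multiplicative subshift. The following are equivalent. (1) $\Omega$ is mixing. (2) $\mathsf{X}_\Omega^{(l)}$ is mixing. (3) For all $u,v\in B(\mathsf{X}_\Omega^{(l)})$ there exists $N\in\mathbb{N}$ such that for all $k\ge N$ and all $\alpha\in\mathbb{N}\setminus l\mathbb{N}$ there exists $x\in\mathsf{X}_\Omega^{(l)}$ such that $x|_{s(u)}=u$ and $(\Pi_{|u|\alpha l^k}x)|_{s(v)}=v$.
   Context: $\mathbb{N}=\{1,2,\ldots\}$ and $[i,j]=\{n\in\mathbb{N}: i\le n\le j\}$. A shift space $\Omega\subseteq\mathcal{A}^{\mathbb{N}}$ (one-sided) is a closed set with $\sigma(\Omega)\subseteq\Omega$, where $(\sigma x)_i=x_{i+1}$. $B(\Omega)$ is the set of all admissible words of $\Omega$ (finite words of length $\ge 1$ occurring in elements of $\Omega$), and $|u|$ is the length of $u$. $\Omega$ is mixing if for all $u,v\in B(\Omega)$ there exists $N\in\mathbb{N}$ such that for every $m\ge N$ there exists $x\in\Omega$ with $x_{[1,|u|]}=u$ and $x_{[|u|+m+1,|u|+m+|v|]}=v$. The multiplicative subshift is $\mathsf{X}_\Omega^{(l)}=\{x=(x_k)_{k\ge1}\in\mathcal{A}^{\mathbb{N}} : (x_{i l^{n-1}})_{n\in\mathbb{N}}\in\Omega \text{ for all } i\in\mathbb{N}\}$.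 For $q\in\mathbb{N}$, $\Pi_q$ is defined by $(\Pi_q x)_i=x_{qi}$. $B(\mathsf{X}_\Omega^{(l)})$ is the set of admissible words $u=x|_{[1,n]}$ with $x\in\mathsf{X}_\Omega^{(l)}$ and $n\ge1$; here $|u|=n$ and the support of $u$ is $s(u)=[1,n]$. $\mathsf{X}_\Omega^{(l)}$ is mixing if for all $u,v\in B(\mathsf{X}_\Omega^{(l)})$ there exists $N\in\mathbb{N}$ such that for every $m\ge N$ there exists $x\in\mathsf{X}_\Omega^{(l)}$ with $x_{[1,|u|]}=u$ and $(\Pi_{|u|m}x)|_{[1,|v|]}=v$. *)

(* Defs.v *)
From HB Require Import structures.
From mathcomp Require Import all_boot.
From mathcomp Require Import boolp classical_sets topology function_spaces.

Set Implicit Arguments.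
Unset Strict Implicit.
Unset Printing Implicit Defensive.

Local Open Scope classical_set_scope.

(* The product of discrete topologies on A^N, with N = {1, 2, ...}.  The      *)
(* entry of index k >= 1 is stored at the 0-based position k.-1: points are   *)
(* only read through [coord] and built through [point_of], so that all        *)
(* indices below are 1-based; [coord x 0] and [f 0] are never used.           *)
Definition full_shift (A : finType) : Type :=
  {ptws nat -> discrete_topology A}.

HB.instance Definition _ (A : finType) := Topological.on (full_shift A).

Definition coord (A : finType) (x : full_shift A) (k : nat) : A := x k.-1.

Definition point_of (A : finType) (f : nat -> A) : full_shift A :=
  fun n => f n.+1.

Lemma coord_point_of (A : finType) (f : nat -> A) (k : nat) :
  0 < k -> coord (point_of f) k = f k.
Proof. by case: k. Qed.

Definition shift (A : finType) (x : full_shift A) : full_shift A :=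
  point_of (fun i => coord x i.+1).

Definition Pi (A : finType) (q : nat) (x : full_shift A) : full_shift A :=
  point_of (fun i => coord x (q * i)).

(* The word x_i x_(i+1) ... x_j; it is empty if j < i. *)
Definition restr (A : finType) (x : full_shift A) (i j : nat) : seq A :=
  [seq coord x k | k <- index_iota i j.+1].

Definition shift_space (A : finType) (Omega : set (full_shift A)) : Prop :=
  closed Omega /\ (@shift A) @` Omega `<=` Omega.

Definition words (A : finType) (Omega : set (full_shift A)) : set (seq A) :=
  [set u | exists x i j, [/\ Omega x, 0 < i <= j & u = restr x i j]].

Definition mixing (A : finType) (Omega : set (full_shift A)) : Prop :=
  forall u v, words Omega u -> words Omega v ->
  exists2 N, 0 < N & forall m, N <= m ->
  exists x, [/\ Omega x,
    restr x 1 (size u) = u &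
    restr x (size u + m + 1) (size u + m + size v) = v].

Definition mult_subshift (A : finType) (l : nat) (Omega : set (full_shift A)) :
    set (full_shift A) :=
  [set x | forall i, 0 < i ->
    Omega (point_of (fun n => coord x (i * l ^ (n - 1))))].

(* For multiplicative subshifts, only initial words are admissible. *)
Definition mult_words (A : finType) (X : set (full_shift A)) : set (seq A) :=
  [set u | exists x n, [/\ X x, 1 <= n & u = restr x 1 n]].

Definition mult_mixing (A : finType) (X : set (full_shift A)) : Prop :=
  forall u v, mult_words X u -> mult_words X v ->
  exists2 N, 0 < N & forall m, N <= m ->
  exists x, [/\ X x,
    restr x 1 (size u) = u &
    restr (Pi (size u * m) x) 1 (size v) = v].

(* Main.v *)
Require Import Defs.
From mathcomp Require Import all_boot.
From mathcomp Require Import boolp classical_sets topology function_spaces.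

(* Every positive integer is uniquely g * l ^ e with l not dividing g, so a     *)
(* point of the multiplicative subshift is a free choice of one point of Omega  *)
(* per progression g, g l, g l^2, ...  Dilating v by |u| m puts at most one     *)
(* block on each progression.  If g <= |u|, that block starts at an exponent c  *)
(* with l ^ c >= m, hence far from the prefix prescribed by u, and mixing of    *)
(* Omega joins the two; if g > |u|, there is no prefix, and it suffices to      *)
(* extend the block to the left.  Conversely, on the progression 1, l, l^2, ... *)
(* dilation by l ^ k is a translation by k.                                     *)

Set Implicit Arguments.
Unset Strict Implicit.
Unset Printing Implicit Defensive.

Local Open Scope classical_set_scope.

(** The three conditions are linked in a cycle. For (1) => (2), [core_exists] and [core_unique]
    partition the positive integers into progressions, [mult_subshift_glue] assembles points chosen
    independently on them, and [mixing_chain] supplies these points. Only finitely many pairs, a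
    progression starting in [1,|u|] and one starting in [1,|v|], have to be joined, so one threshold
    serves every progression. (2) => (3) takes m = alpha * l ^ k; (3) => (1) takes alpha = 1 and
    reads only the powers of l. *)

Section Restr.
Variable A : finType.
Implicit Types x y : full_shift A.

Lemma size_restr x n : size (restr x 1 n) = n.
Proof. by rewrite size_map size_iota subn1. Qed.

Lemma restrE x c n :
  restr x c.+1 (c + n) = [seq coord x (c + e).+1 | e <- iota 0 n].
Proof.
by rewrite /restr /index_iota subSS addKn -[c.+1]addn0 iotaDl -map_comp.
Qed.

Lemma restr_prefixP x y c n :
  restr x c.+1 (c + n) = restr y 1 n <->
  forall e, e < n -> coord x (c + e).+1 = coord y e.+1.
Proof.
rewrite restrE (restrE y 0); split=> [/eq_in_map exy e en|exy].
  by apply: exy; rewrite mem_iota.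
by apply/eq_in_map => e; rewrite mem_iota => /exy.
Qed.

End Restr.

Section ShiftSpace.
Variables (A : finType) (Omega : set (full_shift A)).
Hypothesis shiftO : shift_space Omega.

Lemma shift_space_drop x c : Omega x ->
  Omega (point_of (fun i => coord x (c + i))).
Proof.
move=> Ox; elim: c => [|c IHc].
  by congr (Omega _): Ox; apply: funext.
apply: (shiftO.2); exists (point_of (fun i => coord x (c + i))) => //.
by apply: funext => i; rewrite /shift /point_of /coord /= addnS.
Qed.

(** Invariance under the shift moves any occurrence to the start of a point. *)
Lemma words_prefix u : words Omega u ->
  exists y, [/\ Omega y, 0 < size u & u = restr y 1 (size u)].
Proof.
move=> [x [i [j [Ox /andP[i0 ij] ->]]]]; case: i i0 ij => // i _ ij.
exists (point_of (fun k => coord x (i + k))).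
have ->: j = i + (j - i) by rewrite subnKC // ltnW.
have sE : size (restr x i.+1 (i + (j - i))) = j - i.
  by rewrite restrE size_map size_iota.
rewrite sE subn_gt0; split=> //; first exact: shift_space_drop.
by apply/restr_prefixP => e _; rewrite /coord /point_of /= addnS.
Qed.

(** The second block is located by its offset c instead of the gap c - n, so n is added to the
    threshold. *)
Lemma mixing_points y1 y2 n p : mixing Omega ->
    Omega y1 -> Omega y2 -> 0 < n -> 0 < p ->
  exists N, forall c, N <= c -> exists y, [/\ Omega y,
    forall e, e < n -> coord y e.+1 = coord y1 e.+1 &
    forall e, e < p -> coord y (c + e).+1 = coord y2 e.+1].
Proof.
move=> mixO Oy1 Oy2 n0 p0.
have [||N _ HN] := mixO (restr y1 1 n) (restr y2 1 p).
- by exists y1, 1, n.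
- by exists y2, 1, p.
exists (n + N) => c Nc.
have nc : n <= c by apply: leq_trans Nc; rewrite leq_addr.
have [|y [Oy]] := HN (c - n); first by rewrite leq_subRL.
rewrite !size_restr addn1 subnKC // => y1E y2E.
exists y; split=> //; last exact/restr_prefixP.
exact: (iffLR (restr_prefixP y y1 0 n)).
Qed.

End ShiftSpace.

Section MultSubshift.
Variables (A : finType) (l : nat) (Omega : set (full_shift A)).
Hypothesis shiftO : shift_space Omega.
Hypothesis l_gt1 : 2 <= l.

Definition chain (x : full_shift A) i : full_shift A :=
  point_of (fun n => coord x (i * l ^ (n - 1))).

Lemma coord_chain x i e : coord (chain x i) e.+1 = coord x (i * l ^ e).
Proof. by rewrite /chain coord_point_of // subn1. Qed.

Lemma core_exists k : 0 < k ->
  exists g e, [/\ 0 < g, ~~ (l %| g) & k = g * l ^ e].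
Proof.
elim/ltn_ind: k => k IHk k0.
have [/dvdnP[q kE]|ndvd] := boolP (l %| k); last first.
  by exists k, 0; rewrite muln1.
have q0 : 0 < q by move: k0; rewrite kE muln_gt0 => /andP[].
have [|g [e [g0 gl qE]]] := IHk q _ q0; first by rewrite kE ltn_Pmulr.
by exists g, e.+1; rewrite expnSr mulnA -qE.
Qed.

(** If a <= b, cancelling l ^ a leaves g = h * l ^ (b - a), and l would divide g unless a = b. *)
Lemma core_unique g h a b : ~~ (l %| g) -> ~~ (l %| h) ->
  g * l ^ a = h * l ^ b -> g = h /\ a = b.
Proof.
wlog ab : g h a b / a <= b => [hw gl hl E|gl _].
  have [ab|/ltnW ba] := leqP a b; first exact: hw.
  by have [-> ->] := hw _ _ _ _ ba hl gl (esym E).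
rewrite -(subnKC ab) expnD mulnCA mulnC => /eqP.
rewrite eqn_pmul2l ?expn_gt0 ?(ltnW l_gt1) // => /eqP gE.
case: (b - a) gE gl => [->|d ->]; first by rewrite muln1 addn0.
by rewrite expnS mulnCA dvdn_mulr.
Qed.

(** For i = g * l ^ d, the progression of i is [Y g] without its first d entries, hence still in
    [Omega]. *)
Lemma mult_subshift_glue (Y : nat -> full_shift A) :
    (forall g, 0 < g -> Omega (Y g)) ->
  exists2 x, mult_subshift l Omega x &
    forall g e, 0 < g -> ~~ (l %| g) ->
      coord x (g * l ^ e) = coord (Y g) e.+1.
Proof.
move=> OY.
have /choice[f fP] : forall k, exists ge : nat * nat, 0 < k ->
    [/\ 0 < ge.1, ~~ (l %| ge.1) & k = ge.1 * l ^ ge.2].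
  by case=> [|k]; [exists (0, 0) | have [g [e]] := core_exists (ltn0Sn k);
    exists (g, e)].
have l0 : 0 < l by apply: ltnW.
have gl0 g e : 0 < g -> 0 < g * l ^ e by move=> g0; rewrite muln_gt0 g0 expn_gt0 l0.
have xE g e : 0 < g -> ~~ (l %| g) ->
    coord (point_of (fun k => coord (Y (f k).1) (f k).2.+1)) (g * l ^ e)
      = coord (Y g) e.+1.
  move=> g0 gl; rewrite coord_point_of ?gl0 //.
  have [_ hl E] := fP _ (gl0 _ e g0).
  by have [<- <-] := core_unique gl hl E.
eexists; last exact: xE.
move=> i i0; have [g [d [g0 gl iE]]] := core_exists i0.
have := shift_space_drop shiftO d (OY _ g0).
congr (Omega _); apply: funext => n.
by rewrite /point_of subn1 iE -mulnA -expnD xE // addnS.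
Qed.

(** The point sought on the progression of g must carry what u and the dilated v prescribe there; N
    is uniform in g. *)
Lemma mixing_chain xu xv n p : mixing Omega ->
    mult_subshift l Omega xu -> mult_subshift l Omega xv ->
    0 < n -> 0 < p ->
  exists N, forall m, N <= m -> forall g, 0 < g -> exists y, [/\ Omega y,
    forall e, g * l ^ e <= n -> coord y e.+1 = coord xu (g * l ^ e) &
    forall e j, 0 < j <= p -> g * l ^ e = n * m * j ->
      coord y e.+1 = coord xv j].
Proof.
move=> mixO Xu Xv n0 p0; have l0 : 0 < l by apply: ltnW.
have /choice[N HN] := fun ij : 'I_n * 'I_p => mixing_points mixO
  (Xu ij.1.+1 isT) (Xv ij.2.+1 isT) n0 p0.
set T := \max_ij N ij.
have joined i j c : i < n -> j < p -> T <= c -> exists y, [/\ Omega y,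
    forall e, e < n -> coord y e.+1 = coord xu (i.+1 * l ^ e) &
    forall e, e < p -> coord y (c + e).+1 = coord xv (j.+1 * l ^ e)].
  move=> i_n j_p Tc; set ij := (Ordinal i_n, Ordinal j_p).
  have [|y [Oy y1 y2]] := HN ij c.
    by apply: leq_trans Tc; apply: (leq_bigmax ij).
  exists y; split=> // e he; first by rewrite y1 // coord_chain.
  by rewrite y2 // coord_chain.
exists (l ^ T) => m Tm g g0.
have m0 : 0 < m by apply: leq_trans Tm; rewrite expn_gt0 l0.
pose P e := [exists j : 'I_p, g * l ^ e == n * m * j.+1].
have [exP|noP] := pselect (exists e, P e); last first.
  exists (chain xu g); split; first exact: Xu.
    by move=> e _; rewrite coord_chain.
  move=> e [//|j] /= jp E; case: noP; exists e.
  by apply/existsP; exists (Ordinal jp); rewrite E.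
have [c /existsP[[j jp] /= /eqP cE] cmin] := ex_minnP exP.
(* The block on the progression of g starts at the least exponent c, so it is  *)
(* an initial block of the progression of j.+1 in xv.                          *)
have block y : (forall e, e < p -> coord y (c + e).+1 = coord xv (j.+1 * l ^ e)) ->
    forall e i, 0 < i <= p -> g * l ^ e = n * m * i -> coord y e.+1 = coord xv i.
  move=> yE e [//|i] /= ip E.
  have /subnKC ce : c <= e.
    by apply: cmin; apply/existsP; exists (Ordinal ip); rewrite E.
  have iE : j.+1 * l ^ (e - c) = i.+1.
    apply/eqP; rewrite -(@eqn_pmul2l (n * m)) ?muln_gt0 ?n0 //.
    by rewrite mulnA -cE -mulnA -expnD ce E.
  rewrite -iE -[e in LHS]ce yE //; apply: leq_trans ip; rewrite -iE.
  by apply: (leq_trans (ltn_expl _ l_gt1)); rewrite leq_pmull.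
have [gn|ng] := leqP g n.
  (* n * l ^ T <= n * m <= g * l ^ c and g <= n. *)
  have Tc : T <= c.
    rewrite -(leq_exp2l _ _ l_gt1); apply: (leq_trans Tm).
    rewrite -(leq_pmul2l n0); apply: (@leq_trans (g * l ^ c)).
      by rewrite cE leq_pmulr.
    by rewrite leq_mul2r gn orbT.
  case: g g0 gn {exP cmin} P cE block => // g _ gn P cE block.
  have [y [Oy yu yv]] := joined g j c gn jp Tc.
  exists y; split=> //; last exact: block.
  (* e < l ^ e <= g * l ^ e <= n, so a prefix of length n suffices. *)
  move=> e en; apply: yu; apply: leq_trans en.
  by apply: (leq_trans (ltn_expl _ l_gt1)); rewrite leq_pmull.
(* Here c may be below T: the block is placed at T + c, after an arbitrary prefix, and the first T
   entries are then dropped. *)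
have [y [Oy _ yv]] := joined 0 j (T + c) n0 jp (leq_addr _ _).
exists (point_of (fun i => coord y (T + i))); split.
- exact: shift_space_drop.
- move=> e en; move: ng; rewrite ltnNge (leq_trans _ en) //.
  by rewrite leq_pmulr // expn_gt0 l0.
- by apply: block => e ep; rewrite coord_point_of // addnS addnA yv.
Qed.

End MultSubshift.

Theorem theorem1p3 (A : finType) (Omega : set (full_shift A)) (l : nat)
    (hOmega : shift_space Omega) (hl : 2 <= l) :
  [<-> mixing Omega;
       mult_mixing (mult_subshift l Omega);
       forall u v : seq A,
         mult_words (mult_subshift l Omega) u ->
         mult_words (mult_subshift l Omega) v ->
         exists2 N : nat, 0 < N & forall k alpha : nat,
         N <= k -> 0 < alpha -> ~~ (l %| alpha) ->
         exists x : full_shift A,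
           [/\ mult_subshift l Omega x,
               restr x 1 (size u) = u &
               restr (Pi (size u * alpha * l ^ k) x) 1 (size v) = v]].
Proof.
have l0 : 0 < l by apply: ltnW.
have lX0 e : 0 < l ^ e by rewrite expn_gt0 l0.
tfae.
- move=> mixO _ _ [xu [n [Xu n0 ->]]] [xv [p [Xv p0 ->]]].
  have [N HN] := mixing_chain hOmega hl mixO Xu Xv n0 p0.
  exists N.+1 => // m Nm; rewrite !size_restr.
  have /choice[Y HY] : forall g, exists y, 0 < g -> [/\ Omega y,
      forall e, g * l ^ e <= n -> coord y e.+1 = coord xu (g * l ^ e) &
      forall e j, 0 < j <= p -> g * l ^ e = n * m * j ->
        coord y e.+1 = coord xv j].
    move=> g; have [|g0] := posnP g; first by exists xu.
    by have [y Hy] := HN m (ltnW Nm) g g0; exists y.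
  have m0 : 0 < n * m by rewrite muln_gt0 n0 (leq_trans _ Nm).
  have [|x Xx xE] := @mult_subshift_glue A l Omega hOmega hl Y.
    by move=> g /HY[].
  exists x; split=> //.
    apply/(restr_prefixP x xu 0) => e en.
    have [g [d [g0 gl eE]]] := core_exists hl (ltn0Sn e).
    rewrite add0n eE xE //; have [_ + _] := HY g g0.
    by apply; rewrite -eE.
  apply/(restr_prefixP _ xv 0) => e ep; rewrite add0n.
  rewrite /Pi coord_point_of //.
  have [|g [d [g0 gl eE]]] := @core_exists l hl (n * m * e.+1).
    by rewrite muln_gt0 m0.
  rewrite eE xE //; have [_ _] := HY g g0.
  by apply.
- move=> mixX u v Xu Xv; have [N N0 HN] := mixX u v Xu Xv.
  exists N => // k alpha Nk alpha0 _.
  have [|x [Xx xu xv]] := HN (alpha * l ^ k); last first.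
    by exists x; split=> //; rewrite -mulnA.
  apply: (leq_trans Nk); apply: (leq_trans (ltnW (ltn_expl _ hl))).
  by rewrite leq_pmull.
- move=> H u v /(words_prefix hOmega)[yu [Ou su uE]].
  move=> /(words_prefix hOmega)[yv [Ov sv vE]].
  (* The same point is put on every progression; the prefix of length l ^ (|u| - 1) then shows
     exactly |u| entries on the powers of l. *)
  have [zu Xu zuE] := mult_subshift_glue hOmega hl (fun g (_ : 0 < g) => Ou).
  have [zv Xv zvE] := mult_subshift_glue hOmega hl (fun g (_ : 0 < g) => Ov).
  have ndvd1 : ~~ (l %| 1) by rewrite dvdn1 neq_ltn hl orbT.
  have [||N N0 HN] := H (restr zu 1 (l ^ (size u).-1))
                        (restr zv 1 (l ^ (size v).-1)).
  + by exists zu, (l ^ (size u).-1); split.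
  + by exists zv, (l ^ (size v).-1); split.
  exists N => // m Nm.
  (* With k = m + 1 the dilation factor is l ^ (|u| - 1) * l ^ (m + 1) = l ^ (|u| + m), the
     translation that leaves a gap m. *)
  have [x []] := HN m.+1 1 (leqW Nm) isT ndvd1.
  rewrite !size_restr muln1 -expnD => Xx.
  move=> /(restr_prefixP x zu 0) xu /(restr_prefixP _ zv 0) xv.
  have pre (w : seq A) e : e < size w -> (l ^ e).-1 < l ^ (size w).-1.
    by move=> ew; rewrite prednK // leq_exp2l // -ltnS prednK // (leq_trans _ ew).
  exists (chain l x 1); split; first exact: Xx.
    rewrite [RHS]uE; apply/(restr_prefixP _ yu 0) => e eu.
    rewrite add0n coord_chain mul1n.
    have := xu _ (pre _ _ eu); rewrite add0n prednK // => ->.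
    by rewrite -[l ^ e]mul1n zuE.
  rewrite [RHS]vE addn1; apply/restr_prefixP => e ev.
  rewrite coord_chain mul1n.
  have := xv _ (pre _ _ ev).
  rewrite add0n prednK // -[l ^ e in RHS]mul1n zvE // => <-.
  rewrite /Pi coord_point_of // -expnD; congr (coord x (l ^ _)).
  by rewrite addnS -addSn prednK.
Qed.
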